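(* Let $\mathcal P_t$, $t\ge0$, be a Markov semigroup over a Hilbert space $\mathcal H$ admitting a continuous Lyapunov function $V$ (with constants $C_V,\gamma,K_V$). Suppose that there exist $T>0$ and a semimetric $d:\mathcal H\times\mathcal H\to[0,1]$ which is contracting for $\mathcal P_T$ and such that the level set $\{x\in\mathcal H:V(x)\le4K_V\}$ is $d$-small for $\mathcal P_T$. Suppose also that there exists a complete metric $d_0$ on $\mathcal H$ such that $\mathcal P_t$ is Feller on $(\mathcal H,d_0)$ and $d_0\le\sqrt d$. Let $\mu_*$ be the (unique) invariant probability measure of $\mathcal P_t$, let $$\tilde d(x,y)^2=d(x,y)\,(1+V(x)+V(y)),$$ and let $\|\varphi\|_{\tilde d}:=\sup_{x\ne y}\frac{|\varphi(x)-\varphi(y)|}{\tilde d(x,y)}$. Then there exist $\rho<1$ and $t_*>0$ such that $$\|\mathcal P_{t_*}\varphi-\langle\varphi,\mu_*\rangle\|_{\tilde d}\le\rho\,\|\varphi-\langle\varphi,\mu_*\rangle\|_{\tilde d}$$ for all measurable $\varphi:\mathcal H\to\mathbb R$ such that $\|\varphi\|_{\tilde d}<\infty$, where $\langle\varphi,\mu_*\rangle=\int\varphi\,d\mu_*$.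
   Context: $\mathcal H$ carries its Borel $\sigma$-algebra, and $P_t(x,\cdot)$ denote the transition probabilities of $\mathcal P_t$, so $\mathcal P_t\varphi(x)=\int\varphi(z)P_t(x,dz)$. - A semimetric on $\mathcal H$ is a function $d:\mathcal H\times\mathcal H\to\mathbb R_+$ which is symmetric, lower semicontinuous, and satisfies $d(x,y)=0\Leftrightarrow x=y$. - The Wasserstein semimetric is $W_d(\mu_1,\mu_2)=\inf_\Gamma\int d(x,y)\,\Gamma(dx,dy)$ over all couplings $\Gamma$ of the probability measures $\mu_1,\mu_2$. - A measurable $V:\mathcal H\to\mathbb R_+$ is a Lyapunov function for $\mathcal P_t$ if there are positive constants $C_V,\gamma,K_V$ with $\mathcal P_tV(x)\le C_Ve^{-\gamma t}V(x)+K_V$ for all $x\in\mathcal H$, $t\ge0$. - A set $K\subset\mathcal H$ is $d$-small for $\mathcal P_T$ if there is $\varepsilon>0$ with $W_d(P_T(x,\cdot),P_T(y,\cdot))\le1-\varepsilon$ for all $x,y\in K$. - $d:\mathcal H\times\mathcal H\to[0,1]$ is contracting for $\mathcal P_T$ if there is $\alpha<1$ such that $W_d(P_T(x,\cdot),P_T(y,\cdot))\le\alpha\,d(x,y)$ for every pair $x,y$ with $d(x,y)<1$. - $\mathcal P_t$ is Feller on $(\mathcal H,d_0)$ if it maps bounded $d_0$-continuous functions to bounded $d_0$-continuous functions for all $t\ge0$. - Under the hypotheses of the claim, existence and uniqueness of an invariant probability measure (a $\mu_*$ with $\int P_t(x,B)\mu_*(dx)=\mu_*(B)$ for all Borel $B$,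 $t\ge0$) is known (generalised Harris theorem of Hairer, Mattingly and Scheutzow). *)

(* Defs.v *)
From HB Require Import structures.
From mathcomp Require Import all_boot all_order all_algebra.
From mathcomp Require Import all_classical all_reals all_analysis.

Set Implicit Arguments.
Unset Strict Implicit.
Unset Printing Implicit Defensive.
Import Order.TTheory GRing.Theory Num.Theory.
Import numFieldNormedType.Exports.

Local Open Scope classical_set_scope.
Local Open Scope ring_scope.

Notation borel T := (g_sigma_algebraType (@open T)).

Section MarkovSemigroups.
Context {R : realType} {H : completeNormedModType R}.

(* With the completeness of [H], this makes [H] a real Hilbert space. *)
Definition hilbert_dot (dot : {dot H for @idfun R}) : Prop :=
  forall x : H, dot x x = `|x| ^+ 2.

(* Only the kernels [P t] with [0 <= t] are meaningful. *)
Definition markov_semigroup (P : R -> R.-pker (borel H) ~> (borel H)) : Prop :=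
  (forall (x : borel H) (A : set (borel H)), measurable A -> P 0 x A = \d_x A) /\
  (forall s t : R, 0 <= s -> 0 <= t ->
     forall (x : borel H) (A : set (borel H)), measurable A ->
     (P (s + t)%R x A = \int[P s x]_y P t y A)%E).

(* [Rintegral] is [0] when the integral does not exist as a finite number. *)
Definition semigroup_op (P : R -> R.-pker (borel H) ~> (borel H)) (t : R)
    (phi : borel H -> R) (x : borel H) : R :=
  (\int[P t x]_z phi z)%R.

Definition lyapunov (P : R -> R.-pker (borel H) ~> (borel H))
    (V : borel H -> R) (CV gamma KV : R) : Prop :=
  [/\ [/\ 0 < CV, 0 < gamma & 0 < KV],
      measurable_fun [set: borel H] V,
      forall x, 0 <= V x &
      forall (x : borel H) (t : R), 0 <= t ->
        (\int[P t x]_z (V z)%:E <=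
           (CV * expR (- (gamma * t)) * V x + KV)%:E)%E].

Definition semimetric (d : H -> H -> R) : Prop :=
  [/\ forall x y, 0 <= d x y,
      forall x y, d x y = d y x,
      lower_semicontinuous (fun z : H * H => (d z.1 z.2)%:E) &
      forall x y, d x y = 0 <-> x = y].

(* A coupling is a measure on the Borel sets of the topological product, for
   which a lower semicontinuous [d] is always measurable; when [H] is separable
   this is the product of the Borel sigma-algebras. *)
Definition coupling (mu nu : {measure set (borel H) -> \bar R})
    (G : probability (borel (H * H)%type) R) : Prop :=
  forall A : set (borel H), measurable A ->
    G (fst @^-1` A) = mu A /\ G (snd @^-1` A) = nu A.

Definition wasserstein (d : H -> H -> R)
    (mu nu : {measure set (borel H) -> \bar R}) : \bar R :=
  ereal_inf [set (\int[G]_z (d z.1 z.2)%:E)%E |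
              G in [set G | coupling mu nu G]].

Definition d_small (d : H -> H -> R) (Q : R.-pker (borel H) ~> (borel H))
    (K : set H) : Prop :=
  exists2 eps : R, 0 < eps &
    forall x y : H, K x -> K y ->
      (wasserstein d (Q x) (Q y) <= (1 - eps)%:E)%E.

Definition contracting (d : H -> H -> R) (Q : R.-pker (borel H) ~> (borel H))
    : Prop :=
  exists2 alpha : R, alpha < 1 &
    forall x y : H, d x y < 1 ->
      (wasserstein d (Q x) (Q y) <= (alpha * d x y)%:E)%E.

Definition is_metric (d0 : H -> H -> R) : Prop :=
  [/\ forall x y, 0 <= d0 x y,
      forall x y, d0 x y = 0 <-> x = y,
      forall x y, d0 x y = d0 y x &
      forall x y z, d0 x z <= d0 x y + d0 y z].

Definition complete_metric (d0 : H -> H -> R) : Prop :=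
  is_metric d0 /\
  forall u : nat -> H,
    (forall e : R, 0 < e -> exists N : nat, forall m n : nat,
       (N <= m)%N -> (N <= n)%N -> d0 (u m) (u n) < e) ->
    exists l : H, forall e : R, 0 < e -> exists N : nat, forall n : nat,
       (N <= n)%N -> d0 (u n) l < e.

Definition metric_continuous (d0 : H -> H -> R) (phi : H -> R) : Prop :=
  forall (x : H) (e : R), 0 < e -> exists2 r : R, 0 < r &
    forall y : H, d0 x y < r -> `|phi x - phi y| < e.

Definition bounded_real (phi : H -> R) : Prop :=
  exists M : R, forall x : H, `|phi x| <= M.

(* The topology of [d0] is not assumed to be related to the norm topology, so
   the functions for which [semigroup_op] is defined are singled out by their
   Borel measurability. *)
Definition feller (P : R -> R.-pker (borel H) ~> (borel H))
    (d0 : H -> H -> R) : Prop :=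
  forall t : R, 0 <= t -> forall phi : H -> R,
    measurable_fun [set: borel H] (phi : borel H -> R) ->
    bounded_real phi -> metric_continuous d0 phi ->
    bounded_real (semigroup_op P t phi) /\
    metric_continuous d0 (semigroup_op P t phi).

Definition invariant_measure (P : R -> R.-pker (borel H) ~> (borel H))
    (mu : probability (borel H) R) : Prop :=
  forall t : R, 0 <= t -> forall B : set (borel H), measurable B ->
    (\int[mu]_x P t x B = mu B)%E.

Definition dtilde (d : H -> H -> R) (V : H -> R) (x y : H) : R :=
  Num.sqrt (d x y * (1 + V x + V y)).

(* The supremum is taken in [0, +oo], which matters only if [H] is a point. *)
Definition lip_seminorm (e : H -> H -> R) (phi : H -> R) : \bar R :=
  maxe 0%E (ereal_sup [set (`|phi z.1 - phi z.2| / e z.1 z.2)%:E |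
                        z in [set z : H * H | z.1 != z.2]]).

End MarkovSemigroups.

(* Main.v *)
Require Import Defs.
From HB Require Import structures.
From mathcomp Require Import all_boot all_order all_algebra.
From mathcomp Require Import all_classical all_reals all_analysis.
From mathcomp Require Import measurable_realfun ring lra.

Set Implicit Arguments.
Unset Strict Implicit.
Unset Printing Implicit Defensive.
Import Order.TTheory GRing.Theory Num.Theory.
Import numFieldNormedType.Exports.

Local Open Scope classical_set_scope.
Local Open Scope ring_scope.

(** The seminorm ignores additive constants, so the claim says that [P t] is a
    strict contraction, in the seminorm weighted by
    [dtilde d V = sqrt (d * (1 + V + V))], for some large [t].

    A coupling [G] of [P T x] and [P T y] bounds [P_T phi x - P_T phi y] by the
    [G]-integral of [phi u - phi v].  If [phi u - phi v <= L * dtilde d F u v],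
    Cauchy-Schwarz separates [d] from the weight and, [d]'s integral being
    minimised over couplings, yields
      [L * sqrt (W_d (P T x, P T y) * (1 + P_T F x + P_T F y))]
    ([dual_bound_weighted_lip], [semigroup_op_step]).  So the weight is carried
    along by the semigroup, while [d] becomes the Wasserstein distance.

    The transport cost between [P T x] and [P T y] is at most [d x y] for all
    [x] and [y], in the dual form [dual_bound].  So iterating from
    [F = beta * V] keeps [d] as it is and replaces [V] by [P_{kT} V]
    ([semigroup_op_iter]); no coupling has to be glued or selected measurably.
    Once [k] is so large that [P_{kT} V <= V / 4 + KV], using the sharper
    transport bound in the last step gains a factor
    ([weighted_lip_contraction]):
    - if [d x y < 1], or if [V x] and [V y] are both at most [4 * KV], the
      transport cost is at most [a * d x y] with [a < 1], and a small
      [beta] makes the weight grow by less than [1 / a];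
    - otherwise [V x + V y > 4 * KV], and the weight itself shrinks, because
      [P_{kT} V x + P_{kT} V y <= (V x + V y) / 4 + 2 * KV].
    The contraction holds for the weight [1 + beta * V + beta * V]; enough
    iterations absorb the constant that compares it with [1 + V + V]. *)

(** * Composition of kernels *)

Section KernelComposition.
Context {disp : measure_display} {X : measurableType disp} {R : realType}.
Implicit Types (k : R.-pker X ~> X) (m : {measure set X -> \bar R}).

Lemma measurable_Rintegral_kernel k (f : X -> R) :
  measurable_fun [set: X] f ->
  measurable_fun [set: X] (fun x => (\int[k x]_z f z)%R).
Proof.
move=> mf; apply: (measurableT_comp (fine_measurable measurableT)).
under [X in measurable_fun _ X]eq_fun do rewrite integralE.
have mF : measurable_fun [set: X] (EFin \o f) by exact/measurable_EFinP.
by apply: emeasurable_funB; apply: measurable_fun_integral_kernel => //;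
  [exact: measurable_kernel|exact: measurable_funepos
  |exact: measurable_kernel|exact: measurable_funeneg].
Qed.

Lemma ge0_Rintegral_kernel_comp k1 k2 m (x : X) (f : X -> R) :
  (forall A, measurable A -> m A = (\int[k1 x]_y k2 y A)%E) ->
  (forall z, 0 <= f z) ->
  m.-integrable setT (EFin \o f) ->
  (forall y, (k2 y).-integrable setT (EFin \o f)) ->
  (k1 x).-integrable setT (EFin \o (fun y => (\int[k2 y]_z f z)%R)) /\
  (\int[m]_z f z = \int[k1 x]_y (\int[k2 y]_z f z))%R.
Proof.
move=> mE f0 fm fk.
have [mf fmoo] := integrableP _ _ _ fm.
have compE : (\int[m]_z (f z)%:E = \int[k1 x]_y (\int[k2 y]_z f z)%R%:E)%E.
  transitivity (\int[k1 x]_y \int[k2 y]_z (f z)%:E)%E; last first.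
    by apply: eq_integral => y _; rewrite /Rintegral fineK// integrable_fin_num.
  rewrite -(integral_kcomp k1 (kernel.kernel_snd k2) x (f := EFin \o f))//.
  apply: (eq_measure_integral (mkcomp k1 (kernel.kernel_snd k2) x)) => A mA _.
  exact: mE.
have int_ge0 y : 0 <= (\int[k2 y]_z f z)%R by apply: Rintegral_ge0.
split; last by rewrite /Rintegral compE.
apply/integrableP; split.
  by apply/measurable_EFinP/measurable_Rintegral_kernel/measurable_EFinP.
under eq_integral do rewrite gee0_abs ?lee_fin//.
rewrite -compE; apply: le_lt_trans fmoo; apply: ge0_le_integral => //.
- by move=> z _; rewrite lee_fin.
- exact: measurableT_comp.
- by move=> z _; rewrite /= lee_fin ler_norm.
Qed.

(** Integrability of [f] under every [k2 y] matters: [Rintegral] is [0] on a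
    function that is not integrable. *)
Lemma Rintegral_kernel_comp k1 k2 m (x : X) (f : X -> R) :
  (forall A, measurable A -> m A = (\int[k1 x]_y k2 y A)%E) ->
  m.-integrable setT (EFin \o f) ->
  (forall y, (k2 y).-integrable setT (EFin \o f)) ->
  (\int[m]_z f z = \int[k1 x]_y (\int[k2 y]_z f z))%R.
Proof.
move=> mE fm fk.
(* The nonnegative case applies to both terms of f = (f + |f|) - |f|. *)
pose g z := `|f z|; pose h z := f z + `|f z|.
have ig m' : m'.-integrable setT (EFin \o f) -> m'.-integrable setT (EFin \o g).
  by move=> /integrable_norm; apply.
have ih m' : m'.-integrable setT (EFin \o f) -> m'.-integrable setT (EFin \o h).
  move=> i; rewrite (_ : _ \o _ = ((EFin \o f) \+ (EFin \o g))%E)//.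
  by apply: integrableD => //; exact: ig.
have fB (m' : {measure set X -> \bar R}) : m'.-integrable setT (EFin \o f) ->
    (\int[m']_z f z = \int[m']_z h z - \int[m']_z g z)%R.
  move=> i; rewrite -RintegralB//; [|exact: ih|exact: ig].
  by apply: eq_Rintegral => z _; rewrite /h /g addrK.
have [|gk gE] := ge0_Rintegral_kernel_comp mE _ (ig _ fm) (fun y => ig _ (fk y)).
  by move=> z; exact: normr_ge0.
have [|hk hE] := ge0_Rintegral_kernel_comp mE _ (ih _ fm) (fun y => ih _ (fk y)).
  by move=> z; have := ler_norm (- f z); rewrite normrN /h; lra.
rewrite fB// gE hE -RintegralB//.
by apply: eq_Rintegral => y _; rewrite fB.
Qed.

End KernelComposition.

(** * Integrals against probability measures *)

Section ProbabilityIntegrals.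
Context {disp : measure_display} {X : measurableType disp} {R : realType}.
Context (m : {measure set X -> \bar R}) (m1 : m [set: X] = 1%E).

Lemma prob_integrable_cst (c : R) : m.-integrable setT (EFin \o cst c).
Proof.
apply/integrableP; split; first exact/measurable_EFinP.
by rewrite /= integral_cst// m1 mule1 ltry.
Qed.

Lemma prob_Rintegral_cst (c : R) : (\int[m]_z c = c)%R.
Proof. by rewrite Rintegral_cst// m1 /= mulr1. Qed.

Lemma integrable_affine (a b c : R) (f g : X -> R) :
  m.-integrable setT (EFin \o f) -> m.-integrable setT (EFin \o g) ->
  m.-integrable setT (EFin \o (fun z => a + b * f z + c * g z)) /\
  (\int[m]_z (a + b * f z + c * g z) =
   a + b * (\int[m]_z f z) + c * (\int[m]_z g z))%R.
Proof.
move=> fi gi.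
have bf : m.-integrable setT (EFin \o (fun z => b * f z)).
  exact: (integrableZl measurableT _ fi).
have cg : m.-integrable setT (EFin \o (fun z => c * g z)).
  exact: (integrableZl measurableT _ gi).
have abf : m.-integrable setT (EFin \o (fun z => a + b * f z)).
  rewrite (_ : _ \o _ =
    ((EFin \o cst a) \+ (EFin \o (fun z => (b * f z)%R)))%E)//.
  by apply: integrableD => //; exact: prob_integrable_cst.
split.
  rewrite (_ : _ \o _ = ((EFin \o (fun z => (a + b * f z)%R)) \+
    (EFin \o (fun z => (c * g z)%R)))%E)//.
  exact: integrableD.
rewrite RintegralD// RintegralD//; last exact: prob_integrable_cst.
by rewrite !RintegralZl// prob_Rintegral_cst.
Qed.

Lemma prob_Rintegral_le (f : X -> R) (c : R) :
  m.-integrable setT (EFin \o f) -> (forall z, f z <= c) ->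
  (\int[m]_z f z)%R <= c.
Proof.
move=> fi fc; rewrite -[leRHS]prob_Rintegral_cst.
by apply: le_Rintegral => //; exact: prob_integrable_cst.
Qed.

Lemma prob_Rintegral_ge (f : X -> R) (c : R) :
  m.-integrable setT (EFin \o f) -> (forall z, c <= f z) ->
  c <= (\int[m]_z f z)%R.
Proof.
move=> fi fc; rewrite -[leLHS]prob_Rintegral_cst.
by apply: le_Rintegral => //; exact: prob_integrable_cst.
Qed.

End ProbabilityIntegrals.

(** * Borel measurability *)

Section BorelMeasurability.
Context {R : realType}.

Lemma borel_open (T : normedModType R) (A : set T) :
  open A -> measurable (A : set (borel T)).
Proof. exact: sub_sigma_algebra. Qed.

Lemma continuous_borel_measurable (S T : normedModType R) (f : S -> T) :
  continuous f -> measurable_fun [set: borel S] (f : borel S -> borel T).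
Proof.
move=> cf; apply: (@measurability _ _ _ (borel T) _ _ (@open T) erefl) => _ [B oB <-].
apply: borel_open; rewrite setTI; apply: open_comp => // ? _; exact: cf.
Qed.

Lemma lower_semicontinuous_borel_measurable (T : normedModType R)
    (f : T -> \bar R) :
  lower_semicontinuous f -> measurable_fun [set: borel T] (f : borel T -> \bar R).
Proof.
move=> lf; apply: (measurability _ (ErealGenOInfty.measurableE R)).
move=> _ [_ [a ->] <-]; rewrite setTI preimage_itvoy.
by apply: borel_open; move/lower_semicontinuousP : lf; exact.
Qed.

End BorelMeasurability.

(** * Weak Kantorovich duality *)

Section Duality.
Context {R : realType} {H : completeNormedModType R}.
Implicit Types (d : H -> H -> R) (m n : {measure set (borel H) -> \bar R}).

(** The value of the Kantorovich dual problem is at most [w].  This is all that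
    is used of a bound on the Wasserstein semimetric, and unlike such a bound
    it does not presuppose a coupling on the Borel sets of the product, whose
    existence is unclear when the space is not separable. *)
Definition dual_bound d m n (w : R) : Prop :=
  forall (f g : borel H -> R) (c : R), 0 <= c ->
    m.-integrable setT (EFin \o f) -> n.-integrable setT (EFin \o g) ->
    (forall u v, f u - g v <= c * d u v) ->
    (\int[m]_z f z)%R - (\int[n]_z g z)%R <= c * w.

(** Integrating in each variable in turn replaces the product coupling. *)
Lemma le1_dual_bound d m n :
  m setT = 1%E -> n setT = 1%E -> (forall x y, d x y <= 1) ->
  dual_bound d m n 1.
Proof.
move=> m1 n1 d1 f g c c0 fi gi fgd; rewrite lerBlDr addrC -lerBlDr.
apply: prob_Rintegral_ge => // v; rewrite lerBlDr.
apply: prob_Rintegral_le => // u; rewrite -lerBlDl (le_trans (fgd u v))//.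
by rewrite ler_wpM2l.
Qed.

Lemma Rintegral_pushforward_marginal (disp : measure_display)
    (X : measurableType disp) (G : {measure set X -> \bar R}) m (p : X -> borel H) (f : borel H -> R) :
  measurable_fun [set: X] p ->
  (forall A, measurable A -> G (p @^-1` A) = m A) ->
  m.-integrable setT (EFin \o f) ->
  G.-integrable setT (EFin \o (f \o p)) /\
  (\int[m]_z f z = \int[G]_z f (p z))%R.
Proof.
move=> mp Gm fi; have [mf foo] := integrableP _ _ _ fi.
have pushE (h : borel H -> \bar R) :
    (\int[m]_z h z = \int[pushforward G p]_z h z)%E.
  by apply: eq_measure_integral => A mA _; rewrite -Gm.
have fpi : G.-integrable setT (EFin \o (f \o p)).
  apply/integrableP; split; first exact: (measurableT_comp mf mp).
  move: foo; rewrite pushE ge0_integral_pushforward//.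
  exact: measurableT_comp.
split => //; rewrite /Rintegral pushE integral_pushforward//.
Qed.

(** Integrating [f u - g v <= c * d u v] against a coupling leaves the difference
    of the marginal integrals on the left, so [(int f - int g) / c] is a lower
    bound of the transport costs. *)
Lemma wasserstein_dual_bound d m n w :
  semimetric d -> m setT = 1%E -> n setT = 1%E ->
  (wasserstein d m n <= w%:E)%E -> dual_bound d m n w.
Proof.
move=> [d0 _ dlsc _] m1 n1 dw f g c; rewrite le_eqVlt => /predU1P[<-|c0] fi gi fgd.
  (* For c = 0 the infimum over couplings says nothing if it is infinite, but
     f u <= g v holds for all u and v. *)
  have zb := @le1_dual_bound (fun _ _ => 0) m n m1 n1 (fun _ _ => ler01).
  rewrite mul0r -(mul0r 1); apply: (zb f g 0) => // u v.
  by rewrite mul0r -(mul0r (d u v)).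
have md : measurable_fun [set: borel (H * H)%type]
    (fun z : borel (H * H)%type => (d z.1 z.2)%:E).
  exact: (@lower_semicontinuous_borel_measurable R (H * H)%type _ dlsc).
set D := (X in X <= _).
rewrite mulrC -ler_pdivrMr// -lee_fin; apply: le_trans dw.
apply: le_ereal_inf_tmp => _ [G GC <-].
have [|doo] := leP +oo%E (\int[G]_z (d z.1 z.2)%:E)%E.
  by rewrite leye_eq => /eqP ->; rewrite leey.
have di : G.-integrable setT (EFin \o (fun z => d z.1 z.2)).
  apply/integrableP; split => //.
  by under eq_integral do rewrite gee0_abs ?lee_fin//.
have mp1 : measurable_fun [set: borel (H * H)%type] (fst : _ -> borel H).
  by apply: continuous_borel_measurable => z; exact: cvg_fst.
have mp2 : measurable_fun [set: borel (H * H)%type] (snd : _ -> borel H).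
  by apply: continuous_borel_measurable => z; exact: cvg_snd.
have [fi' fE] := Rintegral_pushforward_marginal mp1 (fun A mA => (GC A mA).1) fi.
have [gi' gE] := Rintegral_pushforward_marginal mp2 (fun A mA => (GC A mA).2) gi.
rewrite /D fE gE -RintegralB// -(fineK (integrable_fin_num _ di))// lee_fin.
rewrite ler_pdivrMr// mulrC -/(Rintegral _ _ _) -RintegralZl//.
have Bi : G.-integrable setT (EFin \o (fun z => f z.1 - g z.2)).
  by rewrite (_ : _ \o _ = ((EFin \o (f \o fst)) \- (EFin \o (g \o snd)))%E)//;
    exact: integrableB.
have ci : G.-integrable setT (EFin \o (fun z => c * d z.1 z.2)).
  exact: (integrableZl measurableT _ di).
by apply: le_Rintegral => // z _; exact: fgd.
Qed.
End Duality.

(** * Weighted Lipschitz functions under a transport bound *)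

Section WeightedLipschitz.
Context {R : realType} {H : completeNormedModType R}.
Implicit Types (d e : H -> H -> R) (F phi : H -> R).

(** One-sided: as the costs are symmetric, exchanging [x] and [y] gives the bound
    on the absolute value. *)
Definition weighted_lip (L : R) e phi : Prop :=
  forall x y, phi x - phi y <= L * e x y.

Lemma dtilde_sym d F x y :
  (forall u v, d u v = d v u) -> dtilde d F x y = dtilde d F y x.
Proof. by move=> ds; rewrite /dtilde ds addrAC. Qed.

(** As [d <= 1], [dtilde d F u 0] is at most [1 + F u + F 0], so [phi] grows at
    most like [1 + F]. *)
Lemma weighted_lip_integrable d F phi L (m : {measure set (borel H) -> \bar R}) :
  m setT = 1%E -> (forall x y, d x y <= 1) -> (forall x y, d x y = d y x) ->
  (forall x, 0 <= F x) -> 0 <= L ->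
  measurable_fun [set: borel H] (phi : borel H -> R) ->
  weighted_lip L (dtilde d F) phi ->
  m.-integrable setT (EFin \o (F : borel H -> R)) ->
  m.-integrable setT (EFin \o (phi : borel H -> R)).
Proof.
move=> m1 d1 ds F0 L0 mphi phiL Fi.
pose g (u : borel H) : R := (`|phi 0| + L * (1 + F 0)) + L * F u + 0 * F u.
have [gi _] := integrable_affine m1 (`|phi 0| + L * (1 + F 0)) L 0 Fi Fi.
apply: le_integrable gi => //; first exact/measurable_EFinP.
move=> u _; rewrite /= lee_fin -/(g u).
have F00 := F0 0; have Fu0 := F0 u.
have dle : dtilde d F u 0 <= 1 + F u + F 0.
  have h : 0 <= 1 + F u + F 0 by rewrite !addr_ge0.
  rewrite /dtilde -[leRHS](ger0_norm h) -sqrtr_sqr ler_wsqrtr// expr2 ler_wpM2r//.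
  by apply: le_trans (d1 _ _) _; lra.
have := ler_wpM2l L0 dle; have := phiL u 0; have := phiL 0 u.
rewrite (dtilde_sym _ _ _ ds) => h1 h2 h3.
apply: le_trans (ler_norm _); rewrite ler_norml /g.
by have := ler_norm (phi 0); have := ler_norm (- phi 0); rewrite normrN; lra.
Qed.

(** [le_mul_sqrt] and [mul_sqrt_le] express [L * sqrt (a * b)] as the infimum over
    [s > 0] of a linear function of [a] and [b].  Linearity is what lets the
    Cauchy-Schwarz inequality be proved from a bound on dual potentials. *)
Lemma le_mul_sqrt (D L w B : R) : 0 <= L -> 0 < w -> 0 < B ->
  (forall s, 0 < s -> D <= s * w + L ^+ 2 / (4 * s) * B) ->
  D <= L * Num.sqrt (w * B).
Proof.
rewrite le_eqVlt => /predU1P[<-|L0] w0 B0 Ds.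
  rewrite mul0r leNgt; apply/negP => D0.
  (* For L = 0 the infimum is approached as s tends to 0. *)
  have := Ds (D / (2 * w)); rewrite divr_gt0 ?mulr_gt0// => /(_ isT).
  rewrite expr2 !mul0r addr0 (_ : D / (2 * w) * w = D / 2); last by field; lra.
  by lra.
have p0 : 0 < Num.sqrt w by rewrite sqrtr_gt0.
have q0 : 0 < Num.sqrt B by rewrite sqrtr_gt0.
rewrite sqrtrM ?(ltW w0)//.
(* The value of s that minimises the right-hand side. *)
have s0 : 0 < L * Num.sqrt B / (2 * Num.sqrt w).
  by rewrite divr_gt0 ?mulr_gt0.
have := Ds _ s0; rewrite -[X in _ * X + _](sqr_sqrtr (ltW w0)).
rewrite -[X in _ + _ * X](sqr_sqrtr (ltW B0)).
move: (Num.sqrt w) (Num.sqrt B) p0 q0 {s0} => p q p0 q0.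
congr (_ <= _); field; lra.
Qed.

Lemma mul_sqrt_le (L a b s : R) : 0 <= a -> 0 <= b -> 0 < s ->
  L * Num.sqrt (a * b) <= s * a + L ^+ 2 / (4 * s) * b.
Proof.
move=> a0 b0 s0; rewrite sqrtrM//.
rewrite -[X in _ <= _ * X + _](sqr_sqrtr a0) -[X in _ <= _ + _ * X](sqr_sqrtr b0).
move: (Num.sqrt a) (Num.sqrt b) => p q.
rewrite -subr_ge0 (_ : _ - _ = (2 * s * p - L * q) ^+ 2 / (4 * s)).
  by rewrite divr_ge0 ?sqr_ge0//; lra.
by field; lra.
Qed.

(** Cauchy-Schwarz: for each [s], with [t = L ^+ 2 / (4 * s)], the functions
    [phi - t - t * F] and [phi + t * F] are a pair of dual potentials for the
    cost [s * d]; then [s] is optimised. *)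
Lemma dual_bound_weighted_lip d F phi L w
    (m n : {measure set (borel H) -> \bar R}) :
  m setT = 1%E -> n setT = 1%E ->
  (forall x y, 0 <= d x y) -> (forall x, 0 <= F x) -> 0 <= L -> 0 < w ->
  dual_bound d m n w ->
  weighted_lip L (dtilde d F) phi ->
  m.-integrable setT (EFin \o (phi : borel H -> R)) ->
  n.-integrable setT (EFin \o (phi : borel H -> R)) ->
  m.-integrable setT (EFin \o (F : borel H -> R)) ->
  n.-integrable setT (EFin \o (F : borel H -> R)) ->
  (\int[m]_z (phi : borel H -> R) z)%R - (\int[n]_z (phi : borel H -> R) z)%R <=
  L * Num.sqrt (w * (1 + (\int[m]_z (F : borel H -> R) z)%R +
                         (\int[n]_z (F : borel H -> R) z)%R)).
Proof.
move=> m1 n1 d0 F0 L0 w0 mnw phiL phim phin Fm Fn.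
have Fm0 : 0 <= (\int[m]_z (F : borel H -> R) z)%R by apply: Rintegral_ge0 => z _.
have Fn0 : 0 <= (\int[n]_z (F : borel H -> R) z)%R by apply: Rintegral_ge0 => z _.
apply: le_mul_sqrt => // [|s s0]; first by lra.
set t := L ^+ 2 / (4 * s).
have [fi fE] := integrable_affine m1 (- t) 1 (- t) phim Fm.
have [gi gE] := integrable_affine n1 0 1 t phin Fn.
have := mnw _ _ s (ltW s0) fi gi; rewrite fE gE => h.
suff /h : forall u v : borel H, - t + 1 * phi u + - t * F u -
    (0 + 1 * phi v + t * F v) <= s * d u v by lra.
move=> u v; have B0 : 0 <= 1 + F u + F v by rewrite !addr_ge0.
have := le_trans (phiL u v) (mul_sqrt_le L (d0 u v) B0 s0); rewrite -/t; lra.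
Qed.

End WeightedLipschitz.

(** * Propagation along the semigroup *)

Section SemigroupStep.
Context {R : realType} {H : completeNormedModType R}.
Context (P : R -> R.-pker (borel H) ~> (borel H)) (HP : markov_semigroup P).
Context (V : borel H -> R) (CV gamma KV : R) (HV : lyapunov P V CV gamma KV).
Context (d : H -> H -> R) (Hd : semimetric d) (d_le1 : forall x y : H, d x y <= 1).

Local Notation Pop := (semigroup_op P).

Lemma lyapunov_integrable t x : 0 <= t -> (P t x).-integrable setT (EFin \o V).
Proof.
move=> t0; have [_ mV V0 Vt] := HV; apply/integrableP; split.
  exact/measurable_EFinP.
under eq_integral do rewrite gee0_abs ?lee_fin//.
by rewrite (le_lt_trans (Vt x t t0))// ltry.
Qed.

Lemma semigroup_op_lyapunov_le t x : 0 <= t ->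
  Pop t V x <= CV * expR (- (gamma * t)) * V x + KV.
Proof.
move=> t0; have [_ _ _ Vt] := HV; rewrite -lee_fin.
by rewrite fineK ?Vt// integrable_fin_num//; exact: lyapunov_integrable.
Qed.

Lemma semigroup_op_lyapunov_ge0 t x : 0 <= Pop t V x.
Proof. by have [_ _ V0 _] := HV; apply: Rintegral_ge0. Qed.

Lemma semigroup_op_measurable t (phi : borel H -> R) :
  measurable_fun [set: borel H] phi -> measurable_fun [set: borel H] (Pop t phi).
Proof. exact: measurable_Rintegral_kernel. Qed.

Lemma semigroup_op0 (phi : borel H -> R) :
  measurable_fun [set: borel H] phi -> Pop 0 phi = phi.
Proof.
move=> mphi; apply/funext => x; rewrite /semigroup_op /Rintegral.
rewrite (eq_measure_integral (dirac x)); last by move=> A mA _; exact: HP.1.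
by rewrite integral_dirac// ?diracT ?mul1e//; exact/measurable_EFinP.
Qed.

Lemma semigroup_opD s t (phi : borel H -> R) : 0 <= s -> 0 <= t ->
  (forall r x, 0 <= r -> (P r x).-integrable setT (EFin \o phi)) ->
  Pop (s + t) phi = Pop s (Pop t phi).
Proof.
move=> s0 t0 phii; apply/funext => x; apply: Rintegral_kernel_comp.
- by move=> A mA; rewrite HP.2.
- by apply: phii; rewrite addr_ge0.
- by move=> y; exact: phii.
Qed.

Lemma semigroup_op_lyapunov_integrable s t x : 0 <= s -> 0 <= t ->
  (P s x).-integrable setT (EFin \o Pop t V).
Proof.
move=> s0 t0; have [_ _ V0 _] := HV.
apply: (ge0_Rintegral_kernel_comp (m := P (s + t) x) (k2 := P t) _ V0 _ _).1.
- by move=> A mA; rewrite HP.2.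
- by apply: lyapunov_integrable; rewrite addr_ge0.
- by move=> y; exact: lyapunov_integrable.
Qed.

Context (beta : R) (beta0 : 0 <= beta).

(** At [t = 0] this is the cost weighted by [1 + beta * V + beta * V]. *)
Definition lyapunov_cost t : H -> H -> R := dtilde d (fun x => beta * Pop t V x).

Lemma lyapunov_cost_integrable t L phi :
  0 <= t -> 0 <= L -> measurable_fun [set: borel H] (phi : borel H -> R) ->
  weighted_lip L (lyapunov_cost t) phi ->
  forall s x, 0 <= s -> (P s x).-integrable setT (EFin \o (phi : borel H -> R)).
Proof.
move=> t0 L0 mphi phiL s x s0; have [_ ds _ _] := Hd.
apply: (weighted_lip_integrable _ d_le1 ds _ L0 mphi phiL).
- exact: prob_kernel.
- by move=> y; rewrite mulr_ge0// semigroup_op_lyapunov_ge0.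
- exact: (integrableZl measurableT _ (semigroup_op_lyapunov_integrable x s0 t0)).
Qed.

(** The weight moves from [P_t V] to [P_s (P_t V) = P_{s + t} V], whereas [d] is
    replaced by the transport bound [w]. *)
Lemma semigroup_op_step s t L w x y phi :
  0 <= s -> 0 <= t -> 0 <= L -> 0 < w ->
  measurable_fun [set: borel H] (phi : borel H -> R) ->
  weighted_lip L (lyapunov_cost t) phi ->
  dual_bound d (P s x) (P s y) w ->
  Pop s phi x - Pop s phi y <=
  L * Num.sqrt (w * (1 + beta * Pop (s + t) V x + beta * Pop (s + t) V y)).
Proof.
move=> s0 t0 L0 w0 mphi phiL dw; have [d0 _ _ _] := Hd.
have Vti z := semigroup_op_lyapunov_integrable z s0 t0.
have phii z := lyapunov_cost_integrable t0 L0 mphi phiL z s0.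
rewrite semigroup_opD//; last by move=> *; exact: lyapunov_integrable.
rewrite -[beta * _ x]RintegralZl// -[beta * _ y]RintegralZl//.
apply: (@dual_bound_weighted_lip _ _ d (fun z => beta * Pop t V z)) => //.
- exact: prob_kernel.
- exact: prob_kernel.
- by move=> z; rewrite mulr_ge0// semigroup_op_lyapunov_ge0.
- exact: (integrableZl measurableT _ (Vti x)).
- exact: (integrableZl measurableT _ (Vti y)).
Qed.

(** Using only the non-strict bound [d x y] on the transport cost leaves [d]
    unchanged, so that the decay of [P_{kT} V] accumulates at no cost in [d]. *)
Lemma semigroup_op_iter T L phi : 0 <= T -> 0 <= L ->
  measurable_fun [set: borel H] (phi : borel H -> R) ->
  (forall x y, x != y -> dual_bound d (P T x) (P T y) (d x y)) ->
  weighted_lip L (lyapunov_cost 0) phi ->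
  forall k, weighted_lip L (lyapunov_cost (k%:R * T)) (Pop (k%:R * T) phi).
Proof.
move=> T0 L0 mphi dT phiL; have [d0 _ _ dxx] := Hd.
elim=> [|k IHk]; first by rewrite mul0r semigroup_op0.
have kT0 : 0 <= k%:R * T by rewrite mulr_ge0.
rewrite -natr1 mulrDl mul1r (addrC _ T) semigroup_opD//; last first.
  by move=> r x r0; exact: (lyapunov_cost_integrable (lexx 0) L0).
move=> x y; have [->|xy] := eqVneq x y.
  by rewrite subrr mulr_ge0// sqrtr_ge0.
apply: semigroup_op_step => //; last exact: dT.
  by rewrite lt_neqAle d0 andbT; apply: contra_neq xy => /esym/dxx.
exact: semigroup_op_measurable.
Qed.

End SemigroupStep.

(** * Contraction in a weighted seminorm *)

Section HarrisContraction.
Context {R : realType} {H : completeNormedModType R}.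
Context (P : R -> R.-pker (borel H) ~> (borel H)) (HP : markov_semigroup P).
Context (V : borel H -> R) (CV gamma KV : R) (HV : lyapunov P V CV gamma KV).
Context (d : H -> H -> R) (Hd : semimetric d) (d_le1 : forall x y : H, d x y <= 1).
Context (T : R) (T_gt0 : 0 < T) (d_contr : contracting d (P T)).
Context (d_level : d_small d (P T) [set x : H | V x <= 4 * KV]).

(** [a] is at least the contraction constant, and at least [1 - eps] on the level
    set.  For the remaining pairs, at distance [1] and not both in the level set,
    [d <= 1] alone bounds the dual problem by [1]. *)
Lemma wasserstein_rate : exists a : R, [/\ 0 < a, a < 1 &
  forall x y, x != y ->
    dual_bound d (P T x) (P T y) (d x y) /\
    (d x y < 1 \/ V x <= 4 * KV /\ V y <= 4 * KV ->
     dual_bound d (P T x) (P T y) (a * d x y))].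
Proof.
have [alpha alpha1 contr] := d_contr; have [eps eps0 small] := d_level.
have [d0 _ _ dxx] := Hd.
(* The term 1 / 2 keeps a positive whatever the sign of alpha and 1 - eps. *)
pose a := Num.max (1 / 2) (Num.max alpha (1 - eps)).
have a2 : 1 / 2 <= a by rewrite /a le_max lexx.
have aalpha : alpha <= a by rewrite /a !le_max lexx orbT.
have aeps : 1 - eps <= a by rewrite /a !le_max lexx !orbT.
have a1 : a < 1 by rewrite /a !gt_max alpha1; apply/and3P; split => //; lra.
have P1 x : P T x setT = 1%E by exact: prob_kernel.
have dbW x y w w' : dual_bound d (P T x) (P T y) w -> w <= w' ->
    dual_bound d (P T x) (P T y) w'.
  move=> h ww f g c c0 fi gi fg; apply: le_trans (h _ _ _ c0 fi gi fg) _.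
  by rewrite ler_wpM2l.
exists a; split => [|//|x y xy]; first by lra.
have near : d x y < 1 \/ V x <= 4 * KV /\ V y <= 4 * KV ->
    dual_bound d (P T x) (P T y) (a * d x y).
  have [dlt _|dge] := ltP (d x y) 1.
    apply: dbW (wasserstein_dual_bound Hd (P1 x) (P1 y) (contr x y dlt)) _.
    by rewrite ler_wpM2r.
  move=> [//|[Vx Vy]].
  apply: dbW (wasserstein_dual_bound Hd (P1 x) (P1 y) (small x y Vx Vy)) _.
  by apply: le_trans aeps _; rewrite ler_peMr//; lra.
split => //; have [dlt|dge] := ltP (d x y) 1.
  apply: dbW (near (or_introl dlt)) _; rewrite ler_piMl// ltW//.
exact: dbW (le1_dual_bound (P1 x) (P1 y) d_le1) dge.
Qed.

Lemma exists_expR_small : exists n : nat,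
  CV * expR (- (gamma * (n.+1%:R * T))) <= 1 / 4.
Proof.
have [[CV0 g0 _] _ _ _] := HV.
have gT : 0 < gamma * T by rewrite mulr_gt0.
exists (Num.bound (4 * CV / (gamma * T))).
set n := Num.bound _.
have h : 4 * CV < n%:R * (gamma * T).
  rewrite -ltr_pdivrMr//; apply: archi_boundP.
  by rewrite divr_ge0 ?ltW// mulr_gt0.
rewrite expRN ler_pdivrMr ?expR_gt0//.
have := expR_ge1Dx (gamma * (n.+1%:R * T)).
by rewrite -natr1; nra.
Qed.

(** The two cases of the argument: pairs on which transport contracts, where
    the weight must not grow much, and pairs with [V x + V y > 4 * KV], where
    the weight contracts. *)
Lemma weighted_lip_contraction : exists beta q t0 : R,
  [/\ 0 < beta, 0 <= q < 1, 0 < t0 &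
   forall L phi, 0 <= L -> measurable_fun [set: borel H] (phi : borel H -> R) ->
     weighted_lip L (dtilde d (fun x => beta * V x)) phi ->
     weighted_lip (L * Num.sqrt q) (dtilde d (fun x => beta * V x))
       (semigroup_op P t0 phi)].
Proof.
have [[CV0 g0 KV0] mV V0 _] := HV.
have [d0 ds _ dxx] := Hd.
have [a [a0 a1 dbnd]] := wasserstein_rate.
have [n nP] := exists_expR_small.
have T0 := ltW T_gt0.
(* With beta * KV = (1 - a) / 4, the weight grows at most by 1 + (1 - a) / 2 in
   the first case, so that the factor is at most (1 + a) / 2.  In the second it
   is at most (1 + 3 * beta * KV) / (1 + 4 * beta * KV).  Both are below q. *)
pose beta := (1 - a) / (4 * KV); pose q := (7 + a) / 8.
have beta0 : 0 < beta by rewrite divr_gt0//; lra.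
have bK : beta * KV = (1 - a) / 4 by rewrite /beta; field; lra.
have t0 : 0 < n.+1%:R * T by rewrite mulr_gt0.
exists beta, q, (n.+1%:R * T); split => //; first by rewrite /q; lra.
move=> L phi L0 mphi phiL x y; have [->|xy] := eqVneq x y.
  by rewrite subrr !mulr_ge0// sqrtr_ge0.
have dxy : 0 < d x y.
  by rewrite lt_neqAle d0 andbT; apply: contra_neq xy => /esym/dxx.
have costE : dtilde d (fun x => beta * V x) = lyapunov_cost P V d beta 0.
  by rewrite /lyapunov_cost semigroup_op0.
have [dT dTa] := dbnd x y xy.
have nT0 : 0 <= n%:R * T by rewrite mulr_ge0.
have phiL0 : weighted_lip L (lyapunov_cost P V d beta 0) phi by rewrite -costE.
have nL := semigroup_op_iter HP HV Hd d_le1 (ltW beta0) T0 L0 mphi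
  (fun x y xy => (dbnd x y xy).1) phiL0 n.
have step w : 0 < w -> dual_bound d (P T x) (P T y) w ->
    semigroup_op P (n.+1%:R * T) phi x - semigroup_op P (n.+1%:R * T) phi y <=
    L * Num.sqrt (w * (1 + beta * semigroup_op P (n.+1%:R * T) V x
                         + beta * semigroup_op P (n.+1%:R * T) V y)).
  move=> w0 dw; rewrite -natr1 mulrDl mul1r (addrC _ T).
  rewrite (semigroup_opD HP (phi := phi))//; last first.
    move=> r z r0.
    exact: (lyapunov_cost_integrable HP HV Hd d_le1 (ltW beta0) (lexx 0) L0 mphi phiL0).
  apply: (semigroup_op_step HP HV Hd d_le1 (ltW beta0)) => //.
  exact: semigroup_op_measurable.
have PVle z : beta * semigroup_op P (n.+1%:R * T) V z <=
    beta * V z / 4 + (1 - a) / 4.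
  rewrite -bK -mulrA -mulrDr ler_wpM2l ?(ltW beta0)//.
  apply: le_trans (semigroup_op_lyapunov_le HV z (ltW t0)) _.
  by rewrite lerD2r [leRHS]mulrC ler_wpM2r// -[4^-1]mul1r.
have PV0 z : 0 <= beta * semigroup_op P (n.+1%:R * T) V z.
  by rewrite mulr_ge0 ?(ltW beta0)// (semigroup_op_lyapunov_ge0 HV).
have bV0 z : 0 <= beta * V z by rewrite mulr_ge0 ?(ltW beta0).
suff [w [w0 dw wle]] : exists w, [/\ 0 < w, dual_bound d (P T x) (P T y) w &
    w * (1 + beta * semigroup_op P (n.+1%:R * T) V x
           + beta * semigroup_op P (n.+1%:R * T) V y) <=
    q * (d x y * (1 + beta * V x + beta * V y))].
  apply: le_trans (step _ w0 dw) _; rewrite -[leRHS]mulrA ler_wpM2l//.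
  by rewrite /dtilde -sqrtrM ?ler_wsqrtr//; rewrite /q; lra.
have hx := PVle x; have hy := PVle y; have px := PV0 x; have py := PV0 y.
move: (bV0 x) (bV0 y) hx hy px py.
have bVx : 4 * KV < V x -> 1 - a < beta * V x.
  by move=> h; have -> : 1 - a = beta * (4 * KV); [lra|rewrite ltr_pM2l].
have bVy : 4 * KV < V y -> 1 - a < beta * V y.
  by move=> h; have -> : 1 - a = beta * (4 * KV); [lra|rewrite ltr_pM2l].
have [nr|far] := pselect (d x y < 1 \/ V x <= 4 * KV /\ V y <= 4 * KV).
  move=> vx vy hx hy px py; exists (a * d x y); split.
  - by rewrite mulr_gt0.
  - exact: dTa.
  - rewrite (mulrC a) -mulrA (mulrCA q) ler_pM2l// /q.
    set X := beta * semigroup_op _ _ _ _ in hx px *.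
    set Y := beta * semigroup_op _ _ _ _ in hy py *.
    nra.
have S4 : 1 - a < beta * V x + beta * V y.
  have [Vx|/bVx] := leP (V x) (4 * KV); last by have := bV0 y; lra.
  have [Vy|/bVy] := leP (V y) (4 * KV); last by have := bV0 x; lra.
  by exfalso; apply: far; right.
move=> vx vy hx hy px py; exists (d x y); split => //.
rewrite (mulrCA q) ler_pM2l// /q.
nra.
Qed.

Lemma weighted_lip_iter : exists beta r t0 : R,
  [/\ 0 < beta, 0 <= r < 1, 0 < t0 &
   forall L phi m, 0 <= L -> measurable_fun [set: borel H] (phi : borel H -> R) ->
     weighted_lip L (dtilde d (fun x => beta * V x)) phi ->
     weighted_lip (L * r ^+ m) (dtilde d (fun x => beta * V x))
       (semigroup_op P (m%:R * t0) phi)].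
Proof.
have [beta [q [t0 [beta0 /andP[q0 q1] t00 contr]]]] := weighted_lip_contraction.
exists beta, (Num.sqrt q), t0; split => //.
  by rewrite sqrtr_ge0 -sqrtr1 ltr_sqrt.
move=> L phi m L0 mphi phiL; elim: m => [|m IHm].
  by rewrite mul0r mulr1 semigroup_op0.
have mt0 : 0 <= m%:R * t0 by rewrite mulr_ge0// ltW.
rewrite -natr1 mulrDl mul1r addrC (semigroup_opD HP)//.
- rewrite exprSr mulrA; apply: contr => //.
    by rewrite mulr_ge0// exprn_ge0// sqrtr_ge0.
  exact: semigroup_op_measurable.
- exact: ltW.
- move=> s x s0.
  apply: (lyapunov_cost_integrable HP HV Hd d_le1 (ltW beta0) (lexx 0) L0) => //.
  by rewrite /lyapunov_cost semigroup_op0//; case: HV.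
Qed.

End HarrisContraction.

(** * The seminorm and the conclusion *)

Section LipSeminorm.
Context {R : realType} {H : completeNormedModType R}.
Implicit Types (e d : H -> H -> R) (phi F G : H -> R).

Lemma lip_seminorm_ge0 e phi : (0 <= lip_seminorm e phi)%E.
Proof. by rewrite /lip_seminorm le_max lexx. Qed.

Lemma lip_seminorm_subr e phi c :
  lip_seminorm e (fun x => phi x - c) = lip_seminorm e phi.
Proof.
congr (maxe _ (ereal_sup _)); apply: eq_imagel => z _.
by rewrite opprB addrA subrK.
Qed.

Lemma lip_seminorm_le e phi L :
  (forall x y, e x y = e y x) -> (forall x y, x != y -> 0 < e x y) -> 0 <= L ->
  weighted_lip L e phi -> (lip_seminorm e phi <= L%:E)%E.
Proof.
move=> es e0 L0 phiL; rewrite /lip_seminorm ge_max lee_fin L0 /=.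
apply: ub_ereal_sup => _ [[x y] /= xy <-].
rewrite lee_fin ler_pdivrMr ?e0// ler_norml phiL andbT lerNl opprB es.
exact: phiL.
Qed.

Lemma weighted_lip_seminorm e phi :
  (forall x y, 0 <= e x y) -> (forall x y, x != y -> 0 < e x y) ->
  (lip_seminorm e phi < +oo)%E ->
  weighted_lip (fine (lip_seminorm e phi)) e phi.
Proof.
move=> e0 epos foo x y.
have [->|xy] := eqVneq x y; first by rewrite subrr mulr_ge0// fine_ge0// lip_seminorm_ge0.
apply: le_trans (ler_norm _) _; rewrite -ler_pdivrMr ?epos// -lee_fin fineK.
  by rewrite /lip_seminorm le_max; apply/orP; right; apply: ereal_sup_ubound; exists (x, y).
by rewrite ge0_fin_numE// lip_seminorm_ge0.
Qed.

Lemma dtilde_le d F G c x y :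
  0 <= d x y -> 0 <= c -> 1 + F x + F y <= c * (1 + G x + G y) ->
  dtilde d F x y <= Num.sqrt c * dtilde d G x y.
Proof.
move=> d0 c0 FG; rewrite /dtilde -sqrtrM// ler_wsqrtr//.
by rewrite mulrCA ler_wpM2l.
Qed.

End LipSeminorm.

Lemma exists_expr_small (R : realType) (r M : R) : 0 <= r < 1 -> 0 <= M ->
  exists m : nat, M * r ^+ m.+1 <= 1 / 2.
Proof.
move=> /andP[r0 r1] M0.
have rcvg : r ^+ n @[n --> \oo] --> (0 : R).
  by apply: cvg_expr; rewrite ger0_norm.
have e0 : 0 < 1 / (2 * (M + 1)) by rewrite divr_gt0//; lra.
have /cvgrPdist_le/(_ _ e0)[N _ /(_ N.+1 (leqnSn _))] := rcvg.
rewrite /= sub0r normrN ger0_norm ?exprn_ge0// => h; exists N.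
rewrite ler_pdivlMr in h; last by lra.
have : 0 <= r ^+ N.+1 by rewrite exprn_ge0.
by nra.
Qed.

Theorem corollary3p5
    (R : realType) (H : completeNormedModType R)
    (dot : {dot H for @idfun R}) (Hdot : hilbert_dot dot)
    (P : R -> R.-pker (borel H) ~> (borel H)) (HP : markov_semigroup P)
    (V : H -> R) (CV gamma KV : R)
    (HV : lyapunov P V CV gamma KV) (Vcont : continuous V)
    (T : R) (T_gt0 : 0 < T)
    (d : H -> H -> R) (Hd : semimetric d) (d_le1 : forall x y : H, d x y <= 1)
    (d_contr : contracting d (P T))
    (d_level : d_small d (P T) [set x : H | V x <= 4 * KV])
    (d0 : H -> H -> R) (Hd0 : complete_metric d0) (HF : feller P d0)
    (d0_le : forall x y : H, d0 x y <= Num.sqrt (d x y))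
    (mu : probability (borel H) R) (Hmu : invariant_measure P mu) :
  exists rho tstar : R, [/\ rho < 1, 0 < tstar &
    forall phi : borel H -> R,
      measurable_fun [set: borel H] phi ->
      (lip_seminorm (dtilde d V) phi < +oo)%E ->
      (lip_seminorm (dtilde d V)
         (fun x => semigroup_op P tstar phi x - \int[mu]_z phi z)%R <=
       rho%:E *
       lip_seminorm (dtilde d V) (fun x => phi x - \int[mu]_z phi z)%R)%E].
Proof.
have [_ _ V0 _] := HV; have [dge0 ds _ dxx] := Hd.
have [beta [r [t0 [beta0 r01 t00 contr]]]] :=
  weighted_lip_iter HP HV Hd d_le1 T_gt0 d_contr d_level.
pose M := Num.sqrt (1 + beta^-1) * Num.sqrt (1 + beta).
have M0 : 0 <= M by rewrite mulr_ge0 ?sqrtr_ge0.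
have [m mP] := exists_expr_small r01 M0.
have dV_sym x y := dtilde_sym V x y ds.
have dV_ge0 x y : 0 <= dtilde d V x y by exact: sqrtr_ge0.
have dV_gt0 x y : x != y -> 0 < dtilde d V x y.
  move=> xy; rewrite sqrtr_gt0 mulr_gt0//.
    by rewrite lt_neqAle dge0 andbT; apply: contra_neq xy => /esym/dxx.
  by have := V0 x; have := V0 y; lra.
have bi0 : 0 < beta^-1 by rewrite invr_gt0.
have dV_beta x y :
    dtilde d V x y <= Num.sqrt (1 + beta^-1) * dtilde d (fun z => beta * V z) x y.
  apply: dtilde_le => //; first by rewrite addr_ge0// ltW.
  rewrite [leRHS](_ : _ = (1 + V x + V y) + (beta^-1 + beta * V x + beta * V y)).
    by rewrite lerDl !addr_ge0 ?mulr_ge0 ?(ltW beta0) ?(ltW bi0).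
  by field; rewrite gt_eqF.
have beta_dV x y :
    dtilde d (fun z => beta * V z) x y <= Num.sqrt (1 + beta) * dtilde d V x y.
  apply: dtilde_le => //; first by rewrite addr_ge0// ltW.
  by have := V0 x; have := V0 y; nra.
exists (1 / 2), (m.+1%:R * t0); split; [by lra|by rewrite mulr_gt0|].
move=> phi mphi phioo; rewrite !lip_seminorm_subr.
set L := lip_seminorm _ phi; have L0 : (0 <= L)%E by exact: lip_seminorm_ge0.
have phiL := weighted_lip_seminorm dV_ge0 dV_gt0 phioo; rewrite -/L in phiL.
have fL0 : 0 <= fine L by exact: fine_ge0.
rewrite -(fineK (_ : L \is a fin_num)) ?ge0_fin_numE// -EFinM.
apply: lip_seminorm_le => //; first by rewrite mulr_ge0.
have phib : weighted_lip (fine L * Num.sqrt (1 + beta^-1))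
    (dtilde d (fun z => beta * V z)) phi.
  by move=> x y; apply: le_trans (phiL x y) _; rewrite -mulrA ler_wpM2l.
have fLb : 0 <= fine L * Num.sqrt (1 + beta^-1) by rewrite mulr_ge0 ?sqrtr_ge0.
move=> x y; apply: le_trans (contr _ _ m.+1 fLb mphi phib x y) _.
have c0 : 0 <= fine L * Num.sqrt (1 + beta^-1) * r ^+ m.+1.
  by rewrite mulr_ge0// exprn_ge0//; case/andP: r01.
apply: le_trans (ler_wpM2l c0 (beta_dV x y)) _; rewrite mulrA ler_wpM2r//.
have := ler_wpM2l fL0 mP; rewrite /M; congr (_ <= _); ring.
Qed.
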